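(* Let $S$ be a finitely generated inverse semigroup and let $d$ be a positive integer. Then there are at most finitely many distinct closed inverse subsemigroups $L$ of $S$ of index $[S:L]=d$.
   Context: Finitely generated means generated as an inverse semigroup by a finite set. The natural partial order on an inverse semigroup $S$ with idempotent set $E(S)$ is $s\leq t \iff s=et$ for some $e\in E(S)$. A subset $A\subseteq S$ is closed if $a\in A$ and $a\leq s$ imply $s\in A$; the closure of $B\subseteq S$ is $B^{\uparrow}=\{s\in S: s\geq b \text{ for some } b\in B\}$. A closed inverse subsemigroup is a (non-empty) inverse subsemigroup that is a closed subset. For a closed inverse subsemigroup $L$ of $S$, a (right) coset of $L$ in $S$ is a subset of the form $(Ls)^{\uparrow}$ with $s\in S$ and $ss^{-1}\in L$. The index $[S:L]$ is the cardinality of the set of right cosets of $L$ in $S$. *)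

(* Defs.v *)
From HB Require Import structures.
From mathcomp Require Import all_boot.
From mathcomp Require Import classical_sets cardinality.

Set Implicit Arguments.
Unset Strict Implicit.
Unset Printing Implicit Defensive.

Local Open Scope classical_set_scope.
Local Open Scope group_scope.

(* The inverse operation of the library's [baseGroupType] cannot be reused
   here, because that structure also carries a distinguished unit. *)
HB.mixin Record Semigroup_isInverse S of Semigroup S := {
  sinv : S -> S;
  mulgKinv : forall s : S, s * sinv s * s = s;
  sinvKmul : forall s : S, sinv s * s * sinv s = sinv s;
  sinv_uniq : forall s t : S, s * t * s = s -> t * s * t = t -> t = sinv s
}.

#[short(type="inverseSemigroupType")]
HB.structure Definition InverseSemigroup :=
  { S of Semigroup S & Semigroup_isInverse S }.

Section InverseSemigroup.
Variable S : inverseSemigroupType.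
Implicit Types (s t e : S) (A B L : set S).

Definition idempotents : set S := [set e | e * e = e].

Definition nat_le s t := exists2 e, idempotents e & s = e * t.

Definition up_closed A := forall a s, A a -> nat_le a s -> A s.

Definition up_closure B : set S := [set s | exists2 b, B b & nat_le b s].

Definition mul_inv_closed A :=
  (forall s t, A s -> A t -> A (s * t)) /\ (forall s, A s -> A (sinv s)).

Definition inverse_subsemigroup A := A !=set0 /\ mul_inv_closed A.

Definition closed_inverse_subsemigroup L :=
  inverse_subsemigroup L /\ up_closed L.

(* [mul_inv_closed] allows the empty set, so nothing is generated by [set0]. *)
Definition generates A := smallest mul_inv_closed A = setT.

Definition finitely_generated := exists2 A : set S, finite_set A & generates A.

Definition right_coset L s : set S := up_closure [set l * s | l in L].

Definition right_cosets L : set (set S) :=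
  [set right_coset L s | s in [set s | L (s * sinv s)]].

Definition has_index L (d : nat) : Prop := (right_cosets L #= `I_d)%card.

End InverseSemigroup.

Arguments finitely_generated S : clear implicits.

(* Main.v *)
Require Import Defs.
From mathcomp Require Import all_boot.
From mathcomp Require Import boolp classical_sets cardinality.

Set Implicit Arguments.
Unset Strict Implicit.
Unset Printing Implicit Defensive.

Local Open Scope classical_set_scope.

(* [S] acts on the right cosets of [L] by partial bijections, and [L] is the
   stabiliser of the coset [L] itself.  The elements of [S] on which two such
   actions agree are closed under product and inverse, so, once the [d] cosets
   are numbered, the action is determined by its values on a finite generating
   set.  Hence [L] is determined by the number of the coset [L] and a relation
   on [{0, ..., d-1}] for every generator: finitely many possibilities. *)

(** Finitely many fibres of [C], one for each [k], cover [P], and each has at most one point in [P].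
    [C] is a relation so that a code may depend on auxiliary choices. *)
Lemma finite_set_code (T : Type) (K : finType) (P : set T)
    (C : T -> K -> Prop) :
  (forall x, P x -> exists k, C x k) ->
  (forall x y k, P x -> P y -> C x k -> C y k -> x = y) ->
  finite_set P.
Proof.
move=> Ctot Cinj.
apply: (@sub_finite_set _ _ (\bigcup_(k in [set: K]) [set x | P x /\ C x k])).
  by move=> x Px; have [k Cxk] := Ctot x Px; exists k.
apply: bigcup_finite => [|k _]; first exact: finite_finset.
have [[x [Px Cx]]|nex] := pselect (exists x, P x /\ C x k).
  apply: (@sub_finite_set _ _ [set x]); last exact: finite_set1.
  by move=> y [Py Cy]; exact: Cinj Py Px Cy Cx.
apply: (@sub_finite_set _ _ set0); last exact: finite_set0.
by move=> y Py; apply: nex; exists y.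
Qed.

Local Open Scope group_scope.

(** * Idempotents and the natural partial order *)

Section InverseSemigroupTheory.
Variable S : inverseSemigroupType.
Implicit Types (s t u x y e f : S).

Lemma mulgKinvA u s : u * s * sinv s * s = u * s.
Proof. by rewrite -!mulgA (mulgA s) mulgKinv. Qed.

Lemma sinvKmulA u s : u * sinv s * s * sinv s = u * sinv s.
Proof. by rewrite -!mulgA (mulgA (sinv s)) sinvKmul. Qed.

Lemma sinvK s : sinv (sinv s) = s.
Proof. by apply/esym/sinv_uniq; rewrite (mulgKinv, sinvKmul). Qed.

Lemma idempotent_sinv e : idempotents e -> sinv e = e.
Proof. by move=> ee; apply/esym/sinv_uniq; rewrite !ee. Qed.

(** For [x = (e f)^-1], the element [f x e] is again an inverse of [e f], so it equals [x] by
    uniqueness. This form shows that [x] is idempotent, hence self-inverse, so [e f = x^-1 = x]. *)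
Lemma idempotent_mul e f : idempotents e -> idempotents f ->
  idempotents (e * f).
Proof.
move=> ee ff; set x := sinv (e * f).
have xE : f * x * e = x.
  apply: sinv_uniq.
    rewrite !mulgA -(mulgA e f f) ff -(mulgA _ e e) ee.
    by rewrite -(mulgA _ e f) mulgKinv.
  rewrite !mulgA -(mulgA _ e e) ee -(mulgA _ f f) ff.
  by rewrite -(mulgA (f * x) e f) -(mulgA f x) -(mulgA f (x * _) x) sinvKmul.
have xx : idempotents x.
  rewrite /idempotents /= -xE !mulgA -(mulgA (f * x) e f).
  by rewrite -(mulgA f x) -(mulgA f (x * _) x) sinvKmul.
by rewrite -(sinvK (e * f)) -/x (idempotent_sinv xx).
Qed.

(** [f e] is an inverse of [e f], which, being idempotent, is its own inverse. *)
Lemma idempotent_comm e f : idempotents e -> idempotents f -> e * f = f * e.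
Proof.
move=> ee ff.
have efI := idempotent_mul ee ff; have feI := idempotent_mul ff ee.
have mulE e' f' : idempotents e' -> idempotents f' -> idempotents (e' * f') ->
    e' * f' * (f' * e') * (e' * f') = e' * f'.
  move=> e'I f'I efI'.
  by rewrite !mulgA -(mulgA _ f' f') f'I -(mulgA _ e' e') e'I -(mulgA _ e' f').
rewrite -[LHS](idempotent_sinv efI).
by apply/esym/sinv_uniq; apply: mulE.
Qed.

Lemma idempotent_mulV s : idempotents (s * sinv s).
Proof. by rewrite /idempotents /= mulgA mulgKinv. Qed.

Lemma idempotent_Vmul s : idempotents (sinv s * s).
Proof. by rewrite /idempotents /= mulgA sinvKmul. Qed.

Lemma sinvM s t : sinv (s * t) = sinv t * sinv s.
Proof.
have comm := idempotent_comm (idempotent_mulV t) (idempotent_Vmul s).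
apply/esym/sinv_uniq.
  rewrite !mulgA -(mulgA s t) -(mulgA s) -(mulgA s _ s) -(mulgA _ (sinv s) s).
  by rewrite comm !mulgA mulgKinv -mulgA -mulgA (mulgA t) mulgKinv.
rewrite !mulgA -(mulgA (sinv t) (sinv s)) -(mulgA _ t (sinv t)).
rewrite -(mulgA (sinv t) (sinv s * s)) -comm !mulgA.
by rewrite sinvKmul -mulgA -mulgA (mulgA (sinv s)) sinvKmul.
Qed.

Lemma conj_idempotent s e : idempotents e -> idempotents (s * e * sinv s).
Proof.
move=> ee; rewrite /idempotents /= !mulgA -(mulgA _ (sinv s) s).
rewrite -(mulgA s e) (idempotent_comm ee (idempotent_Vmul s)) !mulgA mulgKinv.
by rewrite -(mulgA s e e) ee.
Qed.

Lemma nat_le_mull e s : idempotents e -> nat_le (e * s) s.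
Proof. by exists e. Qed.

(** [s e = (s e s^-1) s], because [e] commutes with [s^-1 s]. *)
Lemma nat_le_mulr s e : idempotents e -> nat_le (s * e) s.
Proof.
move=> ee; exists (s * e * sinv s); first exact: conj_idempotent.
by rewrite -!mulgA (idempotent_comm ee (idempotent_Vmul s)) !mulgA mulgKinv.
Qed.

Lemma nat_le_mid s e t : idempotents e -> nat_le (s * e * t) (s * t).
Proof.
move=> ee; have [f ff ->] := nat_le_mulr s ee.
by rewrite -mulgA; exact: nat_le_mull.
Qed.

Lemma nat_le_mul2r s t u : nat_le s t -> nat_le (s * u) (t * u).
Proof. by move=> [e ee ->]; exists e; rewrite // mulgA. Qed.

Lemma nat_le_trans s t u : nat_le s t -> nat_le t u -> nat_le s u.
Proof.
move=> [e ee ->] [f ff ->]; rewrite mulgA.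
exact: nat_le_mull (idempotent_mul ee ff).
Qed.

End InverseSemigroupTheory.

(** * Right cosets and the partial action on them *)

Section Cosets.
Variable S : inverseSemigroupType.
Implicit Types (s t u x y : S) (L : set S).

Definition coset_domain L : set S := [set s | L (s * sinv s)].

Variables (L : set S) (Lcl : closed_inverse_subsemigroup L).

Let Lmul s t : L s -> L t -> L (s * t).
Proof. by move: Lcl => [[_ [+ _]] _]; apply. Qed.

Let Linv s : L s -> L (sinv s).
Proof. by move: Lcl => [[_ [_ +]] _]; apply. Qed.

Let Lup s t : nat_le s t -> L s -> L t.
Proof. by move: Lcl => [_ up] st Ls; exact: up Ls st. Qed.

(** [x s s^-1 x^-1] lies below [x x^-1]. *)
Lemma coset_domain_mul x s : coset_domain L (x * s) -> coset_domain L x.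
Proof.
rewrite /coset_domain /= sinvM !mulgA -(mulgA x s).
exact: Lup (nat_le_mid _ _ (idempotent_mulV s)).
Qed.

Lemma coset_domain_mulV x y : L (x * sinv y) -> coset_domain L x.
Proof.
move=> Lxy; apply: Lup (Lmul Lxy (Linv Lxy)).
rewrite sinvM sinvK mulgA -(mulgA x).
exact: nat_le_mid (idempotent_Vmul y).
Qed.

(** [l x] lies above [(l x y^-1) y], and [l x y^-1] is in [L]. *)
Lemma right_coset_sub x y : L (x * sinv y) ->
  right_coset L x `<=` right_coset L y.
Proof.
move=> Lxy v [_ [l Ll <-]] lx_le_v.
exists (l * (x * sinv y) * y); first by exists (l * (x * sinv y)); auto.
apply: nat_le_trans lx_le_v; rewrite !mulgA -[_ * _ * y]mulgA.
exact: nat_le_mulr (idempotent_Vmul y).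
Qed.

Lemma right_coset_eqP x y : coset_domain L x -> coset_domain L y ->
  right_coset L x = right_coset L y <-> L (x * sinv y).
Proof.
move=> Lx Ly; split=> [Exy|Lxy].
  have : right_coset L x x.
    exists (x * sinv x * x); first by exists (x * sinv x).
    exact: nat_le_mull (idempotent_mulV x).
  (* [x] lies above some [l y], so [x y^-1] lies above [l (y y^-1)], a product of members of [L]. *)
  rewrite Exy => -[_ [l Ll <-]] /(nat_le_mul2r (sinv y)) le_xy.
  by apply: Lup le_xy _; rewrite -mulgA; exact: Lmul.
apply/seteqP; split; apply: right_coset_sub => //.
by rewrite -(sinvK y) -sinvM; exact: Linv.
Qed.

Lemma right_coset_mem s : L s -> right_coset L s = L.
Proof.
move=> Ls; apply/seteqP; split=> [u [_ [l Ll <-]] lsu|l Ll].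
  by apply: Lup lsu _; exact: Lmul.
exists (l * sinv s * s); first by exists (l * sinv s) => //; auto.
by rewrite -mulgA; exact: nat_le_mulr (idempotent_Vmul s).
Qed.

Lemma mem_right_coset x : coset_domain L x -> right_coset L x = L -> L x.
Proof.
move=> Lx <-; exists (x * sinv x * x); first by exists (x * sinv x).
exact: nat_le_mull (idempotent_mulV x).
Qed.

Lemma coset_domain_mem s : L s -> coset_domain L s.
Proof. by move=> Ls; apply: Lmul => //; exact: Linv. Qed.

(** Right multiplication by [t] is thus a well-defined partial map on cosets. Commuting [y^-1 y]
    with [t t^-1] gives [x t (y t)^-1 = (x y^-1) (y t) (y t)^-1], a product of members of [L]. *)
Lemma right_coset_mul x y t : coset_domain L x -> coset_domain L y ->
  right_coset L x = right_coset L y -> coset_domain L (y * t) ->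
  coset_domain L (x * t) /\ right_coset L (x * t) = right_coset L (y * t).
Proof.
move=> Lx Ly /(right_coset_eqP Lx Ly) Lxy Lyt.
have Lz : L (x * t * sinv (y * t)).
  have -> : x * t * sinv (y * t) = x * sinv y * (y * t * sinv (y * t)).
    rewrite !sinvM !mulgA -(mulgA x (sinv y)) -(mulgA x _ t).
    rewrite -(mulgA x _ (sinv t)).
    rewrite -(mulgA (sinv y * y)) -(idempotent_comm (idempotent_mulV t)
      (idempotent_Vmul y)).
    by rewrite !mulgA sinvKmulA.
  exact: Lmul.
have Lxt := coset_domain_mulV Lz.
by split=> //; apply/right_coset_eqP.
Qed.

(** The graph of a partial map; by [right_coset_mul] the choice of representative does not
    matter. *)
Definition coset_action s (C D : set S) := exists x,
  [/\ coset_domain L x, coset_domain L (x * s),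
      right_coset L x = C & right_coset L (x * s) = D].

Lemma coset_actionM s t C D : coset_action (s * t) C D <->
  exists E, [/\ right_cosets L E, coset_action s C E & coset_action t E D].
Proof.
split=> [[x [Lx Lxst xC xstD]]|[E [_ [x [Lx Lxs xC xsE]] [y [Ly Lyt yE ytD]]]]].
  rewrite mulgA in Lxst xstD; have Lxs := coset_domain_mul Lxst.
  exists (right_coset L (x * s)); split; [by exists (x * s)|..].
    by exists x.
  by exists (x * s).
have [Lxst xstE] := right_coset_mul Lxs Ly (etrans xsE (esym yE)) Lyt.
by exists x; rewrite !mulgA xstE.
Qed.

Lemma coset_actionV s C D : coset_action (sinv s) C D <-> coset_action s D C.
Proof.
have half u A B : coset_action u A B -> coset_action (sinv u) B A.
  (* [x u] represents [B], and [x u u^-1] represents the coset of [x] because [x u u^-1 x^-1] is in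
     [L]. *)
  move=> [x [Lx Lxu xA xuB]]; exists (x * u).
  have Lxuu : coset_domain L (x * u * sinv u).
    by rewrite /coset_domain /= !sinvM sinvK !mulgA mulgKinvA -mulgA -sinvM.
  split=> //; rewrite -xA; apply/right_coset_eqP => //.
  by rewrite -!mulgA mulgA -sinvM.
by split=> [/half|/half//]; rewrite sinvK.
Qed.

Lemma coset_action_stab s : L s <-> coset_action s L L.
Proof.
split=> [Ls|[x [Lx Lxs xL xsL]]].
  have Le : L (s * sinv s) by exact: coset_domain_mem.
  (* The idempotent [s s^-1] is in [L], so it represents [L], and multiplying it by [s] gives
     [s]. *)
  exists (s * sinv s); rewrite mulgKinv.
  by split; [exact: coset_domain_mem|..]; rewrite ?right_coset_mem.
have {}Lx := mem_right_coset Lx xL; have {}Lxs := mem_right_coset Lxs xsL.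
(* [x^-1 (x s)] is in [L] and lies below [s]. *)
apply: Lup (Lmul (Linv Lx) Lxs).
by rewrite mulgA; exact: nat_le_mull (idempotent_Vmul x).
Qed.

Lemma right_cosets_self : right_cosets L L.
Proof.
have [[[s Ls] _] _] := Lcl.
by exists s; [exact: coset_domain_mem|exact: right_coset_mem].
Qed.

End Cosets.

(** * Numbered cosets and agreement of two actions *)

Section Numbering.
Variables (S : inverseSemigroupType) (d : nat).
Implicit Types (L : set S) (c : 'I_d -> set S).

Definition numbering L c := forall C, right_cosets L C <-> exists i, c i = C.

Lemma numbering_exists L : has_index L d -> exists c, numbering L c.
Proof.
rewrite /has_index card_eq_sym => /card_set_bijP[f [fsub _ fsurj]].
exists (f \o val) => C; split=> [/fsurj[i ltid <-]|[i <-]].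
  by exists (Ordinal ltid).
exact: fsub (ltn_ord i).
Qed.

(** The middle coset becomes an index [k], so the relation of a product on indices is the composite
    of those of its factors, with no further reference to [L]. *)
Lemma numbered_actionM L c s t i j :
  closed_inverse_subsemigroup L -> numbering L c ->
  coset_action L (s * t) (c i) (c j) <->
  exists k, coset_action L s (c i) (c k) /\ coset_action L t (c k) (c j).
Proof.
move=> Lcl numc; rewrite (coset_actionM Lcl).
split=> [[E [LE sE tE]]|[k [sk tk]]].
  by have [k kE] := (numc E).1 LE; exists k; rewrite kE.
by exists (c k); split=> //; apply/numc; exists k.
Qed.

Lemma numbered_action_agree (A L L' : set S) c c' :
  generates A ->
  closed_inverse_subsemigroup L -> closed_inverse_subsemigroup L' ->
  numbering L c -> numbering L' c' ->
  (forall s i j, A s ->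
    coset_action L s (c i) (c j) <-> coset_action L' s (c' i) (c' j)) ->
  forall s i j,
    coset_action L s (c i) (c j) <-> coset_action L' s (c' i) (c' j).
Proof.
move=> genA Lcl L'cl numc numc' agreeA s.
pose agree : set S := [set s | forall i j,
  coset_action L s (c i) (c j) <-> coset_action L' s (c' i) (c' j)].
suff : smallest (@mul_inv_closed S) A `<=` agree by rewrite genA; exact.
apply: smallest_sub => [|t At i j]; last exact: agreeA.
split=> [u v uP vP i j|u uP i j]; last by rewrite !coset_actionV.
rewrite !numbered_actionM //.
by split=> -[k [/uP uk /vP vk]]; exists k.
Qed.

End Numbering.

Theorem theorem2p15 (S : inverseSemigroupType) (hS : finitely_generated S)
    (d : nat) (hd : (0 < d)%N) :
  finite_set [set L : set S | closed_inverse_subsemigroup L /\ has_index L d].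
Proof.
have [A /finite_seqP[r Ar] genA] := hS.
(* A code consists of the number of the coset [L] and a truth table of the action of each
   generator. *)
pose K : finType := ('I_d * {ffun seq_sub r * 'I_d * 'I_d -> bool})%type.
pose code (L : set S) (k : K) := exists c : 'I_d -> set S,
  [/\ numbering L c, c k.1 = L &
      forall s i j, k.2 (s, i, j) <-> coset_action L (val s) (c i) (c j)].
apply: (@finite_set_code _ K _ code) => [L [Lcl Ld]|L L' k [Lcl _] [L'cl _]].
  have [c numc] := numbering_exists Ld.
  have [b cb] := (numc L).1 (right_cosets_self Lcl).
  exists (b, [ffun p => `[< coset_action L (val p.1.1) (c p.1.2) (c p.2) >]]).
  exists c; split=> // s i j; rewrite ffunE.
  by split=> [/asboolP|?]; last exact/asboolP.
move=> [c [numc cb codec]] [c' [numc' c'b codec']].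
have codesA s i j : A s ->
    coset_action L s (c i) (c j) <-> coset_action L' s (c' i) (c' j).
  rewrite Ar => rs; have := codec (SeqSub rs) i j.
  by have := codec' (SeqSub rs) i j; rewrite /= => <- <-.
have stabE s : L s <-> L' s.
  rewrite (coset_action_stab Lcl) (coset_action_stab L'cl).
  (* [k.1] numbers [L] under [c] and [L'] under [c'], so both stabiliser conditions concern the same
     pair of indices. *)
  have := numbered_action_agree genA Lcl L'cl numc numc' codesA s k.1 k.1.
  by rewrite cb c'b.
by apply/seteqP; split=> s /stabE.
Qed.
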